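(* Let $p$ be an odd prime, and let $c,d\in\mathbb{Z}$ with $p\nmid cd$. Define $$S_c(d,p):=\left|\left(\frac{i^2+dj^2+c}{p}\right)\right|_{1\le i,j\le (p-1)/2}.$$ Then $$\left(\frac{S_c(d,p)}{p}\right)=\begin{cases}1 & \text{if } \left(\frac cp\right)=1 \text{ and } \left(\frac dp\right)=-1,\\ \left(\frac{-1}{p}\right) & \text{if } \left(\frac cp\right)=\left(\frac dp\right)=-1,\\ \left(\frac{-2}{p}\right) & \text{if } \left(\frac{-c}{p}\right)=\left(\frac dp\right)=1,\\ \left(\frac{-6}{p}\right) & \text{if } \left(\frac{-c}{p}\right)=-1 \text{ and } \left(\frac dp\right)=1.\end{cases}$$
   Context: $\left(\frac{\cdot}{p}\right)$ denotes the Legendre symbol. For a square matrix $[a_{ij}]_{1\le i,j\le m}$, $|a_{ij}|_{1\le i,j\le m}$ denotes its determinant. *)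

(* Defs.v *)
From mathcomp Require Import all_boot all_order all_algebra.

Set Implicit Arguments.
Unset Strict Implicit.
Unset Printing Implicit Defensive.

Import GRing.Theory.

Local Open Scope ring_scope.

(* Legendre symbol (a / p); only meant for p an odd prime. *)
Definition legendre (a : int) (p : nat) : int :=
  if (p %| a)%Z then 0
  else if [exists x : 'I_p, (x%:Z ^+ 2 == a %[mod p])%Z] then 1
  else -1.

(* Ordinals start at 0, hence the shift to indices 1, ..., (p - 1) / 2. *)
Definition S_mx (c d : int) (p : nat) : 'M[int]_((p - 1) %/ 2) :=
  \matrix_(i, j) legendre (i.+1%:Z ^+ 2 + d * j.+1%:Z ^+ 2 + c) p.

Definition S_det (c d : int) (p : nat) : int := \det (S_mx c d p).

(* Main.v *)
Require Import Defs.
From mathcomp Require Import all_boot all_order all_algebra ring.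

(* Let n = (p - 1) / 2. Modulo p the Legendre symbol of x is x^n, and the squares
   a_1, ..., a_n of 1, ..., n satisfy a_i^n = 1. So the entries of S are the
   values of (x + d y + c)^n reduced modulo x^n - 1 and y^n - 1, i.e.
   S = V^T T V with V a Vandermonde matrix and T the matrix of trinomial
   coefficients, whose (0,0) entry absorbs x^n and d^n y^n. Inverting Pascal's
   matrix makes T anti-triangular apart from its first row and gives
   det T = (-1)^C(n-1,2) d^C(n,2) (1 + d^n - (-c)^n) prod_(k<n) C(n,k).
   The product of binomials is n!^(n-1) up to a square; the resulting sign is
   evaluated by Wilson's theorem and the second supplement to quadratic
   reciprocity. *)

Import GRing.Theory.

Local Open Scope ring_scope.

(** * Binomial inversion and the determinant of the trinomial matrix *)

(** Both sides are the coefficient of [X^b] in [X^a = ((X - c) + c)^a], expanded in powers of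
    [X - c]. *)
Lemma sum_binomial_inversion {R : comNzRingType} (c : R) (a b : nat) :
  \sum_(j < a.+1) ('C(a, j)%:R * c ^+ (a - j)) * ('C(j, b)%:R * (- c) ^+ (j - b))
    = (a == b)%:R.
Proof.
have coefXc j : (('X + (- c)%:P) ^+ j)`_b = 'C(j, b)%:R * (- c) ^+ (j - b).
  rewrite addrC exprDn coef_sum; have [ltjb|lebj] := ltnP j b.
    rewrite bin_small // mul0r big1 // => i _.
    rewrite -rmorphXn coefMn coefCM coefXn gtn_eqF ?mulr0 ?mul0rn //.
    exact: leq_trans (ltn_ord i) ltjb.
  rewrite (bigD1 (inord b)) //= big1 ?addr0 => [|i]; last first.
    rewrite -rmorphXn coefMn coefCM coefXn => neq_ib.
    case: (b =P i) neq_ib => [eq_bi|_ _]; last by rewrite mulr0 mul0rn.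
    by case/eqP; apply: val_inj; rewrite /= eq_bi inord_val.
  by rewrite inordK // -rmorphXn coefMn coefCM coefXn eqxx mulr1 mulr_natl.
have -> : (a == b)%:R = ('X^a : {poly R})`_b by rewrite coefXn eq_sym.
rewrite -[X in X ^+ a](subrK c%:P) -polyCN [X in X ^+ a]addrC exprDn coef_sum.
apply: eq_bigr => j _.
by rewrite -rmorphXn coefMn coefCM coefXc -mulrA -[RHS]mulr_natl.
Qed.

(** Row 0 meets the antidiagonal only in the last column; the minor there has the same shape, and
    the cofactor sign [(-1)^n] accounts for ['C(n + 1, 2) = 'C(n, 2) + n]. *)
Lemma det_antidiag {R : comNzRingType} (n : nat) :
  \det (\matrix_(i < n, j < n) (i + j == n.-1)%N%:R : 'M[R]_n)
    = (-1) ^+ 'C(n, 2).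
Proof.
elim: n => [|n IHn]; first by rewrite det_mx00.
rewrite (expand_det_row _ ord0) (bigD1 ord_max) //= big1 ?addr0 => [|j].
  rewrite mxE add0n eqxx mul1r /cofactor /= add0n.
  have -> : row' ord0 (col' ord_max (\matrix_(i < n.+1, j < n.+1)
      (i + j == n)%N%:R)) = \matrix_(i < n, j < n) (i + j == n.-1)%N%:R :> 'M[R]_n.
    apply/matrixP => i j; rewrite !mxE lift0 lift_max addSn.
    by rewrite -[in RHS]eqSS (ltn_predK (ltn_ord i)).
  by rewrite IHn -exprD binS bin1 addnC.
rewrite mxE add0n => neq_j; case: eqP => [eq_j|]; last by rewrite mul0r.
by case/eqP: neq_j; apply: val_inj.
Qed.

(* The exponent n - k - l is truncated only where 'C(n - k, l) vanishes. *)
Definition trinomial_mx {R : comNzRingType} (n : nat) (c d e : R) : 'M[R]_n :=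
  \matrix_(k, l) ('C(n, k)%:R * d ^+ l * ('C(n - k, l)%:R * c ^+ (n - k - l))
                  + e * ((k == 0 :> nat) && (l == 0 :> nat))%:R).

Lemma det_trinomial_mx {R : comNzRingType} (n : nat) (c d e : R) :
  \det (trinomial_mx n.+1 c d e) =
    (\prod_(k < n.+1) 'C(n.+1, k))%:R * d ^+ 'C(n.+1, 2) * (-1) ^+ 'C(n, 2)
    * (e - (- c) ^+ n.+1).
Proof.
pose G : 'M[R]_n.+1 := \matrix_(k, l) ('C(n.+1 - k, l)%:R * c ^+ (n.+1 - k - l)
  + e * ((k == 0 :> nat) && (l == 0 :> nat))%:R).
(* The inverse of the unitriangular Pascal matrix with entries ['C(j, l) * c ^+ (j - l)]. For
   [k > 0], row [k] of [G] is row [n.+1 - k] of that matrix. *)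
pose U : 'M[R]_n.+1 := \matrix_(l, b) ('C(l, b)%:R * (- c) ^+ (l - b)).
have detU : \det U = 1.
  rewrite det_trig; last first.
    by apply/is_trig_mxP => i j ltij; rewrite mxE bin_small ?mul0r.
  by rewrite big1 // => i _; rewrite mxE binn subnn mulr1.
have GUE : G *m U = \matrix_(k, b) ((n.+1 - k == b)%N%:R
    + (k == 0 :> nat)%:R * (e * (b == 0 :> nat)%:R
                            - 'C(n.+1, b)%:R * (- c) ^+ (n.+1 - b))).
  apply/matrixP => k b; rewrite !mxE.
  under eq_bigr => l _ do rewrite !mxE mulrDl.
  rewrite big_split /=.
  have -> : \sum_(l < n.+1) e * ((k == 0 :> nat) && (l == 0 :> nat))%:R
      * ('C(l, b)%:R * (- c) ^+ (l - b)) = (k == 0 :> nat)%:R * (e * (b == 0 :> nat)%:R).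
    rewrite (bigD1 ord0) //= big1 ?addr0 => [|l]; last first.
      by rewrite -val_eqE /= => /negbTE ->; rewrite andbF mulr0 mul0r.
    rewrite bin0n sub0n expr0 mulr1 andbT mulrCA !mulrA.
    by congr (_ * _); rewrite mulrC.
  rewrite mulrBr addrCA addrC; congr (_ + _).
  rewrite -(sum_binomial_inversion c).
  (* Row 0 lacks the term [l = n.+1] of the inversion sum; this term is the correction subtracted in
     [GUE]. *)
  case: (posnP k) => [->|k_gt0]; first by
    rewrite subn0 [in RHS]big_ord_recr /= subnn binn !mul1r addrK.
  rewrite mul0r subr0.
  rewrite [RHS](big_ord_widen n.+1 (fun l => 'C(n.+1 - k, l)%:R * c ^+ (n.+1 - k - l)
     * ('C(l, b)%:R * (- c) ^+ (l - b)))); last first.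
    by rewrite ltn_subrL k_gt0.
  rewrite [RHS]big_mkcond /=; apply: eq_bigr => l _.
  by case: ifPn => //; rewrite -leqNgt => lt_l; rewrite bin_small ?mul0r.
have detG : \det G = (-1) ^+ 'C(n, 2) * (e - (- c) ^+ n.+1).
  (* Column 0 of [G *m U] vanishes below row 0, and deleting both leaves the antidiagonal matrix. *)
  rewrite -[LHS]mulr1 -[in LHS]detU -det_mulmx GUE (expand_det_col _ ord0).
  rewrite (bigD1 ord0) //= big1 ?addr0 => [|k]; last first.
    rewrite -val_eqE mxE /= => /negbTE ->.
    by rewrite subn_eq0 leqNgt ltn_ord mul0r addr0 mul0r.
  rewrite mxE /= subn0 add0r mul1r mulr1 bin0 mul1r mulrC /cofactor.
  rewrite expr0 mul1r -det_antidiag; congr (\det _ * _).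
  apply/matrixP => i j; rewrite !mxE !lift0 subSS mul0r addr0.
  rewrite -(eqn_add2l i) subnKC ?(ltnW (ltn_ord i)) // addnS eq_sym.
  by rewrite -[in RHS]eqSS (ltn_predK (ltn_ord i)).
have -> : trinomial_mx n.+1 c d e =
    diag_mx (\row_k 'C(n.+1, k)%:R) *m G *m diag_mx (\row_l d ^+ l).
  apply/matrixP => k l; rewrite mul_mx_diag mul_diag_mx !mxE.
  case: (posnP k) => [->|_] /=; last by rewrite mulr0 !addr0 mulrAC.
  case: (posnP l) => [->|_] /=; last by rewrite mulr0 !addr0 mulrAC.
  by rewrite bin0 expr0 !mulr1 !mul1r.
rewrite !det_mulmx !det_diag detG natr_prod mulrAC -!mulrA.
congr (_ * _); first by apply: eq_bigr => k _; rewrite mxE.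
congr (_ * _); under eq_bigr => l _ do rewrite mxE.
by rewrite prodrXr -(big_mkord xpredT id) bin2_sum.
Qed.

Lemma det_trinomial_mx_gt0 {R : comNzRingType} (n : nat) (c d e : R) :
  (0 < n)%N ->
  \det (trinomial_mx n c d e) =
    (\prod_(k < n) 'C(n, k))%:R * d ^+ 'C(n, 2) * (-1) ^+ 'C(n.-1, 2)
    * (e - (- c) ^+ n).
Proof. by case: n => // n _; exact: det_trinomial_mx. Qed.

(** * Vandermonde factorization and the product of binomials *)

Lemma trinomial_mx_Vandermonde {R : comNzRingType} (n : nat) (c d : R)
    (a : 'rV[R]_n) :
  (forall i, a 0 i ^+ n = 1) ->
  \matrix_(i, j) (a 0 i + d * a 0 j + c) ^+ n
    = (Vandermonde n a)^T *m trinomial_mx n c d (1 + d ^+ n) *m Vandermonde n a.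
Proof.
case: n a => [|n] a aX1; first by apply/matrixP => [[]].
apply/matrixP => i j; rewrite !mxE; set x := a 0 i; set y := a 0 j.
under eq_bigr => l _ do rewrite !mxE mulr_suml.
rewrite exchange_big /=.
(* For [k = 0] the last term of the binomial expansion, [(d * y) ^+ n.+1 = d ^+ n.+1], lies outside
   the index range. *)
have inner (k : 'I_n.+1) : \sum_(l < n.+1)
    'C(n.+1 - k, l)%:R * c ^+ (n.+1 - k - l) * (d * y) ^+ l
    = (c + d * y) ^+ (n.+1 - k) - (k == 0 :> nat)%:R * d ^+ n.+1.
  rewrite exprDn; under [in RHS]eq_bigr => l _ do rewrite -mulr_natl mulrA.
  case: (posnP k) => [->|k_gt0].
    by rewrite subn0 [in RHS]big_ord_recr /= subnn binn !mul1r exprMn aX1 mulr1 addrK.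
  rewrite mul0r subr0 [RHS](big_ord_widen n.+1 (fun l => 'C(n.+1 - k, l)%:R
     * c ^+ (n.+1 - k - l) * (d * y) ^+ l)); last first.
    by rewrite ltn_subrL k_gt0.
  rewrite [RHS]big_mkcond /=; apply: eq_bigr => l _.
  by case: ifPn => //; rewrite -leqNgt => lt_l; rewrite bin_small ?mul0r.
transitivity (\sum_(k < n.+1) ('C(n.+1, k)%:R * x ^+ k * (\sum_(l < n.+1)
    'C(n.+1 - k, l)%:R * c ^+ (n.+1 - k - l) * (d * y) ^+ l)
    + (k == 0 :> nat)%:R * (1 + d ^+ n.+1))).
  (* The summand [1 + d ^+ n.+1] restores the two missing terms: [x ^+ n.+1 = 1] and the one
     subtracted in [inner]. *)
  under eq_bigr => k _ do rewrite inner mulrBr -addrA.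
  rewrite big_split /= big_ord_recl /= [X in _ = _ + X]big_ord_recl /=.
  rewrite [X in _ = _ + (_ + X)]big1 => [|k _]; last by rewrite !mul0r mulr0 addr0 oppr0.
  rewrite expr0 bin0 !mul1r addr0 [X in _ = _ + X]addrC addrK.
  rewrite -addrA [d * y + c]addrC [x + _]addrC exprDn big_ord_recr /= subnn expr0 mul1r.
  rewrite binn mulr1n aX1; congr (_ + _); rewrite big_ord_recl /=.
  rewrite expr0 bin0 mulr1n mulr1 subn0; congr (_ + _).
  by apply: eq_bigr => k _; rewrite -mulr_natl -mulrA [x ^+ _ * _]mulrC.
apply: eq_bigr => k _; rewrite mulr_sumr.
have -> : (k == 0 :> nat)%:R * (1 + d ^+ n.+1) =
   \sum_(l < n.+1) (k == 0 :> nat)%:R * (1 + d ^+ n.+1) * (l == 0 :> nat)%:R :> R.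
  by rewrite big_ord_recl big1 /= ?addr0 ?mulr1 // => l _; rewrite mulr0.
rewrite -big_split; apply: eq_bigr => l _ /=; rewrite !mxE [X in _ = X * _]mulrDr [RHS]mulrDl.
congr (_ + _).
  by rewrite exprMn -/x -/y; ring.
case: (posnP k) => [k0|]; last by rewrite !mul0r mulr0 mulr0 mul0r.
case: (posnP l) => [l0|]; last by rewrite !mulr0 mul0r.
by rewrite k0 l0 !expr0 !mulr1 mul1r.
Qed.

(** Multiply [n! = 'C(n, k) * k! * (n - k)!] over [k < n]; the [(n - k)!] run through [1!, ..., n!],
    and one [n!] cancels. *)
Lemma prod_bin_fact (n : nat) :
  (\prod_(k < n) 'C(n, k) * (\prod_(k < n) k`!) ^ 2 = n`! ^ n.-1)%N.
Proof.
case: n => [|n]; first by rewrite !big_ord0.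
apply/eqP; rewrite -(eqn_pmul2r (fact_gt0 n.+1)) -expnSr.
have -> : (n.+1`! ^ n.+1)%N
    = (\prod_(k < n.+1) ('C(n.+1, k) * (k`! * (n.+1 - k)`!)))%N.
  under eq_bigr => k _ do rewrite bin_fact ?(ltnW (ltn_ord k)) //.
  by rewrite prod_nat_const card_ord.
have rev : (\prod_(k < n.+1) (n.+1 - k)`! = (\prod_(k < n.+1) k`!) * n.+1`!)%N.
  transitivity (\prod_(k < n.+2) k`!)%N; last by rewrite big_ord_recr.
  rewrite [RHS]big_ord_recl fact0 mul1n (reindex_inj rev_ord_inj) /=.
  by apply: eq_bigr => k _; rewrite subKn.
by rewrite !big_split /= rev -!mulnA.
Qed.

(** * Squares and Euler's criterion modulo [p] *)

Section PrimeField.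

Variable p : nat.
Hypotheses (p_prime : prime p) (p_odd : odd p).
Local Notation half := ((p - 1) %/ 2)%N.

Lemma double_half_odd : half.*2.+1 = p.
Proof.
by rewrite subn1 divn2 -[in RHS](odd_double_half p) p_odd -{1}(odd_double_half p) p_odd /= doubleK.
Qed.

Lemma half_gt0 : (0 < half)%N.
Proof.
by move: (prime_gt1 p_prime); rewrite -{1}double_half_odd; case: half.
Qed.

Lemma Fp_expp (x : 'F_p) : x ^+ p = x.
Proof.
rewrite -[x]natr_Zp -natrX -(Fp_nat_mod p_prime) fermat_little //.
by rewrite Fp_nat_mod.
Qed.

Lemma Fp_exp_half_sqr (x : 'F_p) : x != 0 -> (x ^+ half) ^+ 2 = 1.
Proof.
move=> x0; apply: (mulfI x0); rewrite mulr1 -exprM muln2 -exprS.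
by rewrite double_half_odd Fp_expp.
Qed.

Lemma Fp_intr_eq0 (a : int) : (a%:~R == 0 :> 'F_p) = (p %| a)%Z.
Proof. by rewrite (dvdz_pcharf (pchar_Fp p_prime)). Qed.

Lemma Fp_natr_neq0 (k : nat) : (0 < k)%N -> (k <= half.*2)%N -> k%:R != 0 :> 'F_p.
Proof.
move=> k_gt0 le_k; rewrite -(dvdn_pcharf (pchar_Fp p_prime)).
by apply/negP => /dvdn_leq; rewrite k_gt0 leqNgt -{1}double_half_odd ltnS le_k => /(_ isT).
Qed.

Lemma Fp_signr_neq : (1 : 'F_p) != -1.
Proof.
rewrite -subr_eq0 opprK -(natrD _ 1 1) Fp_natr_neq0 //.
by move: half_gt0; rewrite -leq_double.
Qed.

(** For roots in [1, ..., (p - 1) / 2], neither the sum nor a nonzero difference is divisible by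
    [p]. *)
Lemma Fp_sqr_inj (i j : 'I_half) :
  i.+1%:R ^+ 2 = j.+1%:R ^+ 2 :> 'F_p -> i = j.
Proof.
move/eqP; rewrite eqf_sqr => /orP[] /eqP eq_ij.
  apply/val_inj/eqP; wlog: i j eq_ij / (i <= j)%N.
    by case: (leqP i j) => [|/ltnW] le_ij /(_ _ _ _ le_ij); rewrite // eq_sym; apply.
  rewrite leq_eqVlt => /orP[] // lt_ij.
  have /eqP[] : (j - i)%:R != 0 :> 'F_p.
    rewrite Fp_natr_neq0 ?subn_gt0 // (leq_trans (leq_subr _ _)) //.
    by rewrite (leq_trans (ltnW (ltn_ord j))) // -addnn leq_addr.
  by rewrite -subSS natrB ?ltnS 1?ltnW // eq_ij subrr.
have /eqP[] : (i.+1 + j.+1)%:R != 0 :> 'F_p.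
  by rewrite Fp_natr_neq0 // -addnn leq_add.
by rewrite natrD eq_ij addNr.
Qed.

Lemma Fp_exp_half_sqr_gt0 (i : 'I_half) : (i.+1%:R ^+ 2) ^+ half = 1 :> 'F_p.
Proof.
rewrite exprAC Fp_exp_half_sqr // Fp_natr_neq0 //.
by rewrite (leq_trans (ltn_ord i)) // -addnn leq_addr.
Qed.

(* The squares of 1, ..., (p-1)/2 already exhaust the roots of X^((p-1)/2) - 1. *)
Lemma Fp_exp_half_eq1 (x : 'F_p) :
  x ^+ half = 1 -> exists i : 'I_half, x = i.+1%:R ^+ 2.
Proof.
move=> x1; pose s := [seq i.+1%:R ^+ 2 | i : 'I_half] : seq 'F_p.
have [/imageP[i _ ->]|xNs] := boolP (x \in s); first by exists i.
have : (size (x :: s) < size ('X^half - 1%:P : {poly 'F_p})%R)%N.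
  apply: max_poly_roots.
  - by rewrite -size_poly_gt0 size_XnsubC ?half_gt0.
  - apply/allP => y; rewrite inE => /predU1P[->|/imageP[i _ ->]];
      by rewrite rootE !hornerE ?x1 ?hornerXn ?Fp_exp_half_sqr_gt0 ?x1 subrr.
  - by rewrite /= xNs map_inj_uniq ?enum_uniq //; exact: Fp_sqr_inj.
by rewrite size_XnsubC ?half_gt0 //= size_map -cardE card_ord ltnn.
Qed.

(** Euler's criterion: for nonzero [a] the power squares to 1, and the value 1 forces [a] to be a
    square. *)
Lemma legendre_Euler (a : int) : (legendre a p)%:~R = a%:~R ^+ half :> 'F_p.
Proof.
rewrite /legendre -Fp_intr_eq0; have [->|a0] := eqVneq.
  by rewrite expr0n eqn0Ngt half_gt0.
have sqrE (x : nat) :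
    (x%:Z ^+ 2 == a %[mod p])%Z = (x%:R ^+ 2 == a%:~R :> 'F_p).
  by rewrite eqz_mod_dvd -Fp_intr_eq0 rmorphB rmorphXn subr_eq0.
case: existsP => [[x]|no_root].
  rewrite sqrE => /eqP eq_a; rewrite -eq_a exprAC Fp_exp_half_sqr //.
  by apply: contraNneq a0 => x0; rewrite -eq_a x0 expr0n.
have := Fp_exp_half_sqr _ a0; move/eqP; rewrite sqrf_eq1 => /orP[/eqP|/eqP -> //].
move/Fp_exp_half_eq1 => [i eq_a]; case: no_root.
have lt_i : (i.+1 < p)%N.
  by rewrite -[X in (_ < X)%N]double_half_odd ltnS (leq_trans (ltn_ord i)) // -addnn leq_addr.
by exists (Ordinal lt_i); rewrite sqrE eq_a.
Qed.

(** The values 0, 1 and -1 stay distinct in ['F_p] since [p] is odd. The value 0 does occur later: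
    -6 vanishes modulo 3. *)
Lemma legendre_eq (a b : int) :
  a%:~R ^+ half = b%:~R ^+ half :> 'F_p -> legendre a p = legendre b p.
Proof.
have N1_neq0 : -1 != 0 :> 'F_p by rewrite oppr_eq0 oner_eq0.
have N1_neq1 : -1 != 1 :> 'F_p by rewrite eq_sym Fp_signr_neq.
have neqE := (oner_eq0, negbTE N1_neq0, negbTE N1_neq1).
rewrite -!legendre_Euler /legendre => /eqP.
by do 2![case: ifP => _; [|case: ifP => _]] => //;
  rewrite ?rmorphN ?rmorph1 ?rmorph0 ?neqE // eq_sym neqE.
Qed.

Lemma legendre1 : legendre 1 p = 1.
Proof.
rewrite /legendre -Fp_intr_eq0 oner_eq0; case: existsP => // -[].
by exists (Ordinal (prime_gt1 p_prime)).
Qed.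

(** * The sign: second supplement and Wilson's theorem *)

(* J is a square root of -1, so (1 + J)^2 = 2 J; compare with the Frobenius
   identity (1 + J)^p = 1 + J^p. *)
Lemma Fp_expN2_half : (- 2%:R : 'F_p) ^+ half = (-1) ^+ half./2.
Proof.
(* The rotation [[[0, 1], [-1, 0]]]: matrices supply a square root of -1 for every [p]. *)
pose J : 'M['F_p]_2 := \matrix_(i, j) ((i == 0 :> nat)%:R - (j == 0 :> nat)%:R).
have J2 : J ^+ 2 = (-1) *: 1.
  apply/matrixP => i j; rewrite expr2 !mxE !big_ord_recl big_ord0 !mxE.
  by case: i j => [[|[|//]] ?] [[|[|//]] ?]; rewrite -val_eqE /=; ring.
have J00 : J 0 0 = 0 by rewrite mxE subrr.
have charM : p \in [pchar 'M['F_p]_2] by rewrite pchar_lalg pchar_Fp.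
have expMp (X : 'M['F_p]_2) : X ^+ p = (X ^+ 2) ^+ half * X.
  by rewrite -exprM mul2n -exprSr double_half_odd.
have := pFrobenius_autD_comm charM (commr1 J).
rewrite !pFrobenius_autE expr1n !expMp J2.
have -> : (J + 1) ^+ 2 = 2%:R *: J.
  by rewrite sqrrD1 J2 scaleN1r addrAC addNr add0r scaler_nat.
rewrite !exprZn expr1n -{2}(odd_double_half half) exprD -mul2n exprM J2 exprZn expr1n.
rewrite -scalerAr -!scalerAl mul1r mulr1.
(* [J] vanishes at [(0, 0)], so this entry isolates the scalar part. The parity of [half] decides
   whether [J ^+ half] is a scalar or a multiple of [J]. *)
move/matrixP/(_ 0 0) => exp2.
have sign2 : (-1) ^+ half./2 * (-1) ^+ half./2 = 1 :> 'F_p by rewrite -expr2 sqrr_sign.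
rewrite [LHS]exprNn -(signr_odd _ half).
rewrite -[LHS]mulr1 -[X in _ * X]sign2 mulrA -[RHS]mul1r; congr (_ * _).
apply: subr0_eq; move: exp2 => /(congr1 (+%R^~ (-1))).
by case: (odd half); rewrite ?expr0 ?expr1 ?mul1r ?mulrDr -?expr2 ?J2 ?mulr1
  !mxE ?J00 /= => exp2;
  (transitivity ((-1) ^+ half * (1 - 1) + 1 - 1 : 'F_p); [rewrite -exp2|]; ring).
Qed.

(** Wilson's theorem, with the upper half of [(p - 1)!] folded onto the lower one by
    [p - k = - k]. *)
Lemma Fp_fact_half_sqr : half`!%:R ^+ 2 = (-1) ^+ half.+1 :> 'F_p.
Proof.
have : (half.*2)`!%:R = -1 :> 'F_p.
  apply/eqP; rewrite -addr_eq0 -mulrSr -(dvdn_pcharf (pchar_Fp p_prime)).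
  by rewrite -[half.*2]/(half.*2.+1.-1) double_half_odd -Wilson ?prime_gt1.
have le_half : (half <= half.*2)%N by rewrite -addnn leq_addr.
rewrite -(ffact_fact le_half) -{2}addnn addnK natrM ffact_prod natr_prod.
have -> : \prod_(i < half) (half.*2 - i)%:R = (-1) ^+ half * half`!%:R :> 'F_p.
  transitivity (\prod_(i < half) (- i.+1%:R) : 'F_p).
    apply: eq_bigr => i _; apply/eqP; rewrite -addr_eq0 -natrD addnS subnK.
      by rewrite double_half_odd -(dvdn_pcharf (pchar_Fp p_prime)).
    exact: leq_trans (ltnW (ltn_ord i)) le_half.
  rewrite prodrN card_ord fact_prod natr_prod; congr (_ * _).
  by rewrite -(big_mkord xpredT (fun i => i.+1%:R)) big_add1.
rewrite -mulrA -expr2 => sqr_fact.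
by rewrite -[LHS](signrMK half) sqr_fact -exprSr.
Qed.

Lemma odd_bin2 (m : nat) : odd 'C(m, 2) = odd m./2.
Proof.
(* Passing from [m] to [m + 2] flips both parities, so the induction carries two consecutive
   cases. *)
suff: odd 'C(m, 2) = odd m./2 /\ odd 'C(m.+1, 2) = odd m.+1./2 by case.
elim: m => // m [IHm IHm1]; split=> //.
by rewrite binS bin1 binS bin1 !oddD IHm /=; case: (odd m) (odd m./2) => [] [].
Qed.

(** The quadratic character of the factor of the determinant free of [c] and [d]. For odd [half] the
    factorial has an even exponent and the sign survives; for even [half] the sign gets an even
    exponent and [half!^2] is known. *)
Lemma Fp_fact_sign_exp_half :
  (half`!%:R ^+ half.-1 * (-1) ^+ 'C(half.-1, 2)) ^+ half
    = (-1) ^+ half./2 :> 'F_p.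
Proof.
have half_doubleE := odd_double_half half.
have fact_neq0 : half`!%:R != 0 :> 'F_p.
  by rewrite -sqrf_eq0 Fp_fact_half_sqr signr_eq0.
rewrite exprMn [X in X * _]exprAC -[X in _ * X]exprM -[X in _ * X]signr_odd oddM odd_bin2.
rewrite -[RHS]signr_odd.
case half_odd: (odd half) half_doubleE => /= half_doubleE.
  have pred_half : half.-1 = half./2.*2 by rewrite -[in LHS]half_doubleE.
  rewrite pred_half -[in X in X * _]mul2n exprM Fp_exp_half_sqr // expr1n mul1r.
  by rewrite doubleK andbT.
have odd_pred : odd half.-1 by rewrite -[odd _]negbK -oddS prednK ?half_gt0 ?half_odd.
have -> : half`!%:R ^+ half = (-1) ^+ odd half./2 :> 'F_p.
  rewrite -[X in _ ^+ X = _]half_doubleE add0n -mul2n exprM Fp_fact_half_sqr.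
  by rewrite -signr_odd /= half_odd expr1 signr_odd.
rewrite andbF mulr1; case: (odd _); last by rewrite expr1n.
by rewrite expr1 -signr_odd odd_pred.
Qed.

(** * The determinant modulo [p] and the four cases *)

Lemma S_det_trinomial (c d : int) :
  exists2 u : 'F_p, u != 0 &
  (S_det c d p)%:~R = u ^+ 2 * (half`!%:R ^+ half.-1 * (-1) ^+ 'C(half.-1, 2))
    * d%:~R ^+ 'C(half, 2) * (1 + d%:~R ^+ half - (- c%:~R) ^+ half).
Proof.
pose a : 'rV['F_p]_half := \row_i i.+1%:R ^+ 2.
pose F : nat := (\prod_(k < half) k`!)%N.
have F_neq0 : F%:R != 0 :> 'F_p.
  rewrite natr_prod; apply/prodf_neq0 => k _; move: (nat_of_ord k) (ltnW (ltn_ord k)).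
  elim=> [|m IHm] lt_m; first exact: oner_neq0.
  rewrite factS natrM mulf_neq0 ?IHm 1?ltnW // Fp_natr_neq0 //.
  by rewrite (leq_trans lt_m) // -addnn leq_addr.
have V_neq0 : \det (Vandermonde half a) != 0.
  rewrite det_Vandermonde; apply/prodf_neq0 => i _; apply/prodf_neq0 => j lt_ij.
  rewrite !mxE subr_eq0; apply: contraTneq lt_ij => /Fp_sqr_inj ->.
  by rewrite ltnn.
(* The Vandermonde determinant enters twice, and the product of binomials has denominator
   [F ^ 2]. *)
exists (\det (Vandermonde half a) / F%:R); first by rewrite mulf_neq0 ?invr_neq0.
have prod_bin : (\prod_(k < half) 'C(half, k))%:R
    = half`!%:R ^+ half.-1 / F%:R ^+ 2 :> 'F_p.
  by rewrite -natrX -prod_bin_fact natrM natrX mulfK ?expf_neq0.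
have -> : (S_det c d p)%:~R = \det (\matrix_(i, j)
    (a 0 i + d%:~R * a 0 j + c%:~R) ^+ half : 'M['F_p]_half).
  rewrite /S_det -det_map_mx; congr (\det _); apply/matrixP => i j.
  rewrite !mxE /= legendre_Euler; congr (_ ^+ _).
  by rewrite !rmorphD rmorphM !rmorphXn.
rewrite trinomial_mx_Vandermonde => [|i]; last by rewrite mxE Fp_exp_half_sqr_gt0.
rewrite !det_mulmx det_tr det_trinomial_mx_gt0 ?half_gt0 // prod_bin.
rewrite exprMn exprVn; ring.
Qed.

Lemma S_det_exp_half (c d : int) :
  ((S_det c d p)%:~R : 'F_p) ^+ half =
  (-1) ^+ half./2 * (d%:~R ^+ half) ^+ 'C(half, 2)
    * (1 + d%:~R ^+ half - (- c%:~R) ^+ half) ^+ half.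
Proof.
have [u u_neq0 ->] := S_det_trinomial c d.
rewrite 3!exprMn Fp_fact_sign_exp_half.
by rewrite [u ^+ 2 ^+ _]exprAC Fp_exp_half_sqr // mul1r [X in _ * X * _]exprAC.
Qed.

End PrimeField.

Theorem theorem1p3 (p : nat) (c d : int) (p_prime : prime p) (p_odd : odd p)
    (p_ndvd_cd : ~~ (p %| c * d)%Z) :
  [/\ legendre c p = 1 -> legendre d p = -1 ->
        legendre (S_det c d p) p = 1,
      legendre c p = -1 -> legendre d p = -1 ->
        legendre (S_det c d p) p = legendre (-1) p,
      legendre (- c) p = 1 -> legendre d p = 1 ->
        legendre (S_det c d p) p = legendre (- 2%:Z) p
    & legendre (- c) p = -1 -> legendre d p = 1 ->
        legendre (S_det c d p) p = legendre (- 6%:Z) p].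
Proof.
set n := ((p - 1) %/ 2)%N.
have EulerE a : (legendre a p)%:~R = a%:~R ^+ n :> 'F_p by exact: legendre_Euler.
have detE : ((S_det c d p)%:~R : 'F_p) ^+ n = _ := S_det_exp_half p p_prime p_odd c d.
have sign2 : ((-1) ^+ n./2) ^+ 2 = 1 :> 'F_p by rewrite sqrr_sign.
(* Here [1 + d^n = 0], so the last factor is [- (-c)^n]; in its [n]-th power, -1 has the even
   exponent [n + n^2]. The power of [d^n] cancels [(-1)^(n./2)]. *)
have nonres : legendre d p = -1 ->
    ((S_det c d p)%:~R : 'F_p) ^+ n = (c%:~R ^+ n) ^+ n.
  move=> ed; rewrite detE -[_ ^+ ((p - 1) %/ 2)]EulerE ed.
  rewrite -[_ ^+ 'C(_, 2)]signr_odd odd_bin2 signr_odd -expr2 sign2 mul1r.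
  rewrite subrr sub0r exprNn [(- c%:~R) ^+ _]exprNn exprMn mulrA -[((-1) ^+ _) ^+ _]exprM.
  by rewrite -[X in _ * X * _]signr_odd oddM andbb signr_odd -expr2 sqrr_sign mul1r.
(* The last factor is [2 - s], and [(-1)^(n./2)] is the [n]-th power of -2; [s = 1] and [s = -1]
   yield -2 and -6. *)
have res s : legendre d p = 1 -> legendre (- c) p = s ->
    ((S_det c d p)%:~R : 'F_p) ^+ n = ((2 - s) * - 2%:Z)%:~R ^+ n.
  move=> ed ec; rewrite detE -[_ ^+ ((p - 1) %/ 2)]EulerE ed expr1n mulr1.
  rewrite -rmorphN -[(- c)%:~R ^+ _]EulerE ec -(Fp_expN2_half p p_prime p_odd).
  by rewrite mulrC -exprMn rmorphM rmorphB rmorphN.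
split=> [ec ed|ec ed|ec ed|ec ed].
- rewrite -(legendre1 p p_prime); apply: legendre_eq => //.
  by rewrite -/n nonres // -EulerE ec.
- by apply: legendre_eq => //; rewrite -/n nonres // -EulerE ec.
- by apply: legendre_eq => //; rewrite -/n (res _ ed ec).
- by apply: legendre_eq => //; rewrite -/n (res _ ed ec).
Qed.
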